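(* Let $q\ge 2$ be a prime power such that $3\mid q^2-1$. Then it is not the case that for every $a\in\mathbb{F}_q$ and every $b\in\mathbb{F}_q^*$ of the form $b=c^3$ with $c$ a primitive element of $\mathbb{F}_q$ there exists a $3$-primitive $1$-normal element $\xi\in\mathbb{F}_{q^2}$ over $\mathbb{F}_q$ such that $\mathrm{Tr}_{\mathbb{F}_{q^2}/\mathbb{F}_q}(\xi^{-1})=ab^{-1}$ and $\mathrm{N}_{\mathbb{F}_{q^2}/\mathbb{F}_q}(\xi)=b$.
   Context: An element $\xi\in\mathbb{F}_{q^2}^*$ is $3$-primitive (where $3\mid q^2-1$) if its multiplicative order is $(q^2-1)/3$. It is $1$-normal over $\mathbb{F}_q$ if the $\mathbb{F}_q$-linear span of $\xi,\xi^q$ has dimension $1$ over $\mathbb{F}_q$. A primitive element of $\mathbb{F}_q$ is a generator of $\mathbb{F}_q^*$. $\mathrm{Tr}_{\mathbb{F}_{q^2}/\mathbb{F}_q}$ and $\mathrm{N}_{\mathbb{F}_{q^2}/\mathbb{F}_q}$ are the trace and norm from $\mathbb{F}_{q^2}$ to $\mathbb{F}_q$. *)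

(* Defs.v *)
From HB Require Import structures.
From mathcomp Require Import all_boot all_order all_fingroup all_algebra all_solvable all_field.

Set Implicit Arguments.
Unset Strict Implicit.
Unset Printing Implicit Defensive.

Import GRing.Theory.
Local Open Scope ring_scope.

(* [n.-primitive_root x] says that n is the least positive exponent killing x,
   i.e. that x has multiplicative order n. *)
Definition three_primitive (F : finFieldType) (L : fieldExtType F) (xi : L) : bool :=
  ((#|F| ^ 2 - 1) %/ 3)%N.-primitive_root xi.

Definition one_normal (F : finFieldType) (L : fieldExtType F) (xi : L) : bool :=
  \dim <<[:: xi; (xi ^+ #|F|)%R]>>%VS == 1%N.

Definition primitive_element (F : finFieldType) (c : {unit F}) : bool :=
  generator [set: {unit F}] c.

(* Main.v *)
Require Import Defs.
From HB Require Import structures.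
From mathcomp Require Import all_boot all_order all_fingroup all_algebra all_solvable all_field.

(** A 1-normal element xi is an eigenvector of the Frobenius map: xi ^ q = l xi
    with l in F_q.  Since Frobenius is F_q-linear and has square the identity
    on F_{q^2}, l ^ 2 = 1, so l = 1 or l = -1.  If l = 1, the order
    (q ^ 2 - 1) / 3 of xi divides q - 1, which forces q = 2 and hence 1 = -1.
    So l = -1 in all cases ([frobenius_oppr]): every 3-primitive 1-normal
    element is sent to its opposite by Frobenius, and so is its inverse,
    whose trace is therefore 0.  A nonzero choice of a contradicts the
    prescribed trace a / b; taking a = 1 works with any primitive c. *)

Set Implicit Arguments.
Unset Strict Implicit.
Unset Printing Implicit Defensive.

Import GRing.Theory.
Local Open Scope ring_scope.

Lemma quadratic_gal_generator (F : finFieldType) (L : splittingFieldType F) :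
    \dim {:L} = 2%N ->
  exists2 alpha : gal_of {:L}, ('Gal({:L} / 1%VS) = [set 1; alpha])%g /\ alpha != 1%g
    & forall x : L, alpha x = x ^+ #|F|.
Proof.
move=> dimL.
have [alpha /eqP gen_alpha frob_alpha] := finField_galois_generator (sub1v {:L}).
have ord_alpha : #[alpha]%g = 2%N.
  rewrite orderE -gen_alpha -galois_dim ?finField_galois ?sub1v //.
  by rewrite dimL dimv1.
exists alpha; last by move=> x; rewrite frob_alpha ?memvf // dimv1 expn1.
by split; [rewrite gen_alpha cycle2g | rewrite -order_gt1 ord_alpha].
Qed.

Lemma quadratic_galTrace (F : finFieldType) (L : splittingFieldType F) (x : L) :
  \dim {:L} = 2%N -> galTrace 1 {:L} x = x + x ^+ #|F|.
Proof.
case/quadratic_gal_generator=> alpha [galE alpha_neq1] frob_alpha.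
rewrite /galTrace galE big_setU1 ?inE 1?eq_sym //= big_set1 gal_id.
by rewrite frob_alpha.
Qed.

(** Frobenius generates a Galois group of order 2, hence is an involution. *)
Lemma quadratic_frobeniusK (F : finFieldType) (L : splittingFieldType F) (x : L) :
  \dim {:L} = 2%N -> (x ^+ #|F|) ^+ #|F| = x.
Proof.
case/quadratic_gal_generator=> alpha [galE alpha_neq1] frob_alpha.
have gal_alpha : alpha \in ('Gal({:L} / 1%VS))%g by rewrite galE !inE eqxx orbT.
have := groupM gal_alpha gal_alpha.
rewrite /= galE !inE -{5}[alpha]mulg1 (inj_eq (mulgI alpha)) (negPf alpha_neq1) orbF.
by move/eqP=> alphaK; rewrite -!frob_alpha -galM ?memvf // alphaK gal_id.
Qed.

Lemma one_normal_eigen (F : finFieldType) (L : fieldExtType F) (xi : L) :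
  xi != 0 -> one_normal xi -> exists l : F, xi ^+ #|F| = l *: xi.
Proof.
move=> xi_neq0 /eqP dim_span; apply/vlineP.
suff /eqP-> : <[xi]>%VS == <<[:: xi; (xi ^+ #|F|)%R]>>%VS.
  by rewrite memv_span // !inE eqxx orbT.
by rewrite eqEdim dim_span dim_vline xi_neq0 -memvE memv_span ?mem_head.
Qed.

(** The order of an element fixed by Frobenius divides q - 1, which is too
    small for the order (q - 1) (q + 1) / 3 unless q + 1 <= 3. *)
Lemma three_primitive_fixed_card (F : finFieldType) (L : fieldExtType F) (xi : L) :
    (3 %| #|F| ^ 2 - 1)%N -> three_primitive xi -> xi != 0 ->
  xi ^+ #|F| = xi -> #|F| = 2%N.
Proof.
rewrite /three_primitive => dvd3 prim_xi xi_neq0 fix_xi.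
have q_gt1 : (1 < #|F|)%N := finNzRing_gt1 F.
have xi_pow1 : xi ^+ #|F|.-1 == 1.
  by apply/eqP/(mulfI xi_neq0); rewrite mulr1 -exprS prednK // ltnW.
rewrite -(prim_order_dvd prim_xi) in xi_pow1.
have /(dvdn_leq _) : (#|F| ^ 2 - 1 %| #|F|.-1 * 3)%N.
  by rewrite -(divnK dvd3) dvdn_pmul2r.
rewrite muln_gt0 -subn1 subn_gt0 q_gt1 => /(_ isT).
rewrite -[X in (_ - X)%N](exp1n 2) subn_sqr leq_pmul2l ?subn_gt0 // addn1 ltnS => q_le2.
by apply/eqP; rewrite eqn_leq q_le2.
Qed.

(** Either the eigenvalue is already -1, or it is 1; in the latter case q = 2
    and there is no difference between 1 and -1. *)
Lemma frobenius_oppr (F : finFieldType) (L : splittingFieldType F) (xi : L) :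
    \dim {:L} = 2%N -> (3 %| #|F| ^ 2 - 1)%N -> xi != 0 ->
  three_primitive xi -> one_normal xi -> xi ^+ #|F| = - xi.
Proof.
move=> dimL dvd3 xi_neq0 prim_xi /(one_normal_eigen xi_neq0)[l frob_xi].
have : l ^+ 2 == 1.
  have := quadratic_frobeniusK xi dimL.
  rewrite frob_xi exprZn expf_card frob_xi scalerA -expr2.
  move/eqP; rewrite -subr_eq0 -{2}[xi]scale1r -scalerBl scaler_eq0.
  by rewrite (negPf xi_neq0) orbF subr_eq0.
rewrite sqrf_eq1 => /orP[] /eqP l_eq; last by rewrite frob_xi l_eq scaleN1r.
have fix_xi : xi ^+ #|F| = xi by rewrite frob_xi l_eq scale1r.
have q_eq2 := three_primitive_fixed_card dvd3 prim_xi xi_neq0 fix_xi.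
(* In the field with two elements, -1 = (-1) ^ 2 = 1. *)
have oneN : - 1 = 1 :> F by rewrite -[LHS]expf_card q_eq2 sqrrN expr1n.
by rewrite fix_xi -scaleN1r oneN scale1r.
Qed.

Lemma ex_primitive_element (F : finFieldType) :
  exists c : {unit F}, primitive_element c.
Proof.
have /cyclicP[c gen_c] := field_unit_group_cyclic [set: {unit F}]%G.
by exists c; apply/eqP.
Qed.

Theorem lemma4p10 (p k q : nat) (F : finFieldType) (L : splittingFieldType F)
    (hp : prime p) (hk : (0 < k)%N) (hpk : q = (p ^ k)%N)
    (hq : (2 <= q)%N) (h3 : (3 %| q ^ 2 - 1)%N)
    (hF : #|F| = q) (hL : \dim {:L} = 2%N) :
  ~ (forall a b : F, b != 0 ->
       (exists c : {unit F}, primitive_element c /\ b = val c ^+ 3) ->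
       exists xi : L,
         [/\ three_primitive xi,
             one_normal xi,
             galTrace 1 {:L} xi^-1 = (a * b^-1)%:A
           & galNorm 1 {:L} xi = b%:A]).
Proof.
move=> all_ab; have [c prim_c] := ex_primitive_element F.
have b_neq0 : val c ^+ 3 != 0 by rewrite expf_neq0 // -unitfE (valP c).
have [|xi [prim_xi norm_xi tr_xi N_xi]] := all_ab 1 _ b_neq0; first by exists c.
have xi_neq0 : xi != 0.
  by rewrite -(galNorm_eq0 1 {:L}) N_xi scaler_eq0 oner_eq0 orbF.
rewrite -hF in h3.
have frob_xi := frobenius_oppr hL h3 xi_neq0 prim_xi norm_xi.
move/eqP: tr_xi; rewrite quadratic_galTrace // exprVn frob_xi invrN subrr.
rewrite eq_sym scaler_eq0 oner_eq0 orbF mul1r invr_eq0.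
by rewrite (negPf b_neq0).
Qed.
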